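(* Let $T=\sum_{j=1}^kQ_jD^j$ be a degenerate exactly-solvable operator of order $k$. Denote by $j_0$ the largest $j$ such that $\deg Q_j=j$ and let $(j-\deg Q_j)\geq (k-\deg Q_k)$ for every $j>j_0$. Then there exists a positive constant $c>0$ such that $$\liminf_{n\to\infty}\frac{r_n}{n^d}\geq c,$$ where $d:=\max_{j\in[j_0+1,k]}\big(\frac{j-j_0}{j-\deg Q_j}\big)=\frac{k-j_0}{k-\deg Q_k}$.
   Context: Here $D=d/dz$, and $[a,b]$ as a range for the index $j$ denotes integers. A degenerate exactly-solvable operator of order $k$ is a linear differential operator $T=\sum_{j=1}^{k}Q_jD^j$ with polynomial coefficients $Q_j\in\mathbb{C}[z]$, $Q_k\not\equiv 0$, such that $\deg Q_j\leq j$ for all $j$, with equality for at least one $j$, and $\deg Q_k<k$. For all sufficiently large integers $n$ there exist a unique constant $\lambda_n$ and a unique monic polynomial $p_n$ of degree $n$ with $T(p_n)=\lambda_n p_n$. For such $n$, $r_n=\max\{|z|:p_n(z)=0\}$. Conditions on $\deg Q_j$ and maxima over $j$ refer only to indices $j$ for which $Q_j$ is not identically zero. *)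

(* Defs.v *)
(* The complex numbers are R[i] for an arbitrary R : realType. *)
From HB Require Import structures.
From mathcomp Require Import all_boot all_order all_algebra.
From mathcomp Require Import all_classical all_reals all_analysis.
From mathcomp Require Import complex.

Set Implicit Arguments.
Unset Strict Implicit.
Unset Printing Implicit Defensive.

Import Order.TTheory GRing.Theory Num.Theory.
Local Open Scope ring_scope.
Local Open Scope complex_scope.
Local Open Scope classical_set_scope.

(* Degree of a nonzero polynomial; every use below is guarded by p != 0. *)
Definition pdeg (R : realType) (p : {poly R[i]}) : nat := (size p).-1.

(* Only the values Q j with 1 <= j <= k matter. *)
Definition diffop (R : realType) (k : nat) (Q : nat -> {poly R[i]})
    (p : {poly R[i]}) : {poly R[i]} :=
  \sum_(1 <= j < k.+1) Q j * p^`(j).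

Definition degenerate_exactly_solvable (R : realType) (k : nat)
    (Q : nat -> {poly R[i]}) : Prop :=
  [/\ Q k != 0,
      forall j, (1 <= j <= k)%N -> Q j != 0 -> (pdeg (Q j) <= j)%N,
      exists j, [/\ (1 <= j <= k)%N, Q j != 0 & pdeg (Q j) = j]
    & (pdeg (Q k) < k)%N].

Definition top_index (R : realType) (k : nat) (Q : nat -> {poly R[i]}) : nat :=
  \max_(1 <= j < k.+1 | (Q j != 0) && (pdeg (Q j) == j)) j.

Definition is_monic_eigenpoly (R : realType) (k : nat) (Q : nat -> {poly R[i]})
    (n : nat) (p : {poly R[i]}) : Prop :=
  [/\ p \is monic, size p = n.+1
    & exists lambda : R[i], diffop k Q p = lambda *: p].

(* For an exactly-solvable operator and n large, exactly one polynomial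
   satisfies is_monic_eigenpoly k Q n, and it is the one picked here; the default
   value 0 can only occur for finitely many n. *)
Definition monic_eigenpoly (R : realType) (k : nat) (Q : nat -> {poly R[i]})
    (n : nat) : {poly R[i]} :=
  xget 0 [set p | is_monic_eigenpoly k Q n p].

(* For nonconstant p the set is finite and nonempty, so that sup is a maximum.
   The norm of R[i] takes its values in R[i], hence the real part. *)
Definition root_radius (R : realType) (p : {poly R[i]}) : R :=
  sup [set complex.Re `|z| | z in [set z : R[i] | root p z]].

(* All terms of the maximum are positive, so the initial value 0 is harmless,
   and deg Q_j <= j, so that no natural-number subtraction truncates. *)
Definition growth_exponent (R : realType) (k : nat) (Q : nat -> {poly R[i]}) : R :=
  let j0 := top_index k Q in
  \big[Num.max/0]_(j0.+1 <= j < k.+1 | Q j != 0)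
    ((j - j0)%:R / (j - pdeg (Q j))%:R).

(* Main.v *)
(* Let p be the monic eigenpolynomial of degree n, and let z have modulus
   t greater than the moduli of all roots of p.  Every root w of p satisfies
   Re (z / (z - w)) >= 1/2, so z p'(z) / p(z) = sum_w z / (z - w) has modulus
   at least n / 2.  In particular p' does not vanish outside the disc containing
   the roots of p, so the bound can be iterated:
   |p^(j)(z)| <= (4 t / n)^(k-j) |p^(k)(z)| once n >= 2 k.
   Dividing lambda_n p(z) = sum_j Q_j(z) p^(j)(z) by p^(k)(z), the eigenvalue
   (of size n^j0) and the terms with j <= j0 contribute O(t^k / n^(k-j0)), while
   by hypothesis the terms with j0 < j < k contribute O(t^(deg Q_k) / n).
   For t large |Q_k(z)| is of order t^(deg Q_k), and comparing the two sides
   gives t^(k - deg Q_k) >= a n^(k-j0).  The choice t = r_n + r with r a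
   constant avoids having to know beforehand that r_n is unbounded. *)
Require Import Defs.
From HB Require Import structures.
From mathcomp Require Import all_boot all_order all_algebra.
From mathcomp Require Import all_classical all_reals all_analysis.
From mathcomp Require Import complex.
From mathcomp Require Import zify ring lra.

Set Implicit Arguments.
Unset Strict Implicit.
Unset Printing Implicit Defensive.

Import Order.TTheory GRing.Theory Num.Theory.
Local Open Scope ring_scope.
Local Open Scope complex_scope.

(** * Logarithmic derivatives outside the disc containing the roots *)

(* Used at x = z / (z - w), for which x - 1 = w / (z - w). *)
Lemma Re_ge_half (C : numClosedFieldType) (x : C) :
  `|x - 1| <= `|x| -> 1 <= 'Re x *+ 2.
Proof.
rewrite -[_ <= `|x|](ler_pXn2r (ltn0Sn 1)) ?nnegrE//.
rewrite !normC2_Re_Im !raddfB /= (Creal_ImP 1 _) ?(Creal_ReP 1 _) ?rpred1//.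
rewrite subr0 lerD2r sqrrB1 => h.
rewrite -subr_ge0 in h; rewrite -subr_ge0; apply: le_trans h _.
by rewrite le_eqVlt; apply/orP; left; apply/eqP; ring.
Qed.

Lemma horner_deriv_prod_XsubC (F : fieldType) (rs : seq F) (z : F) :
  z \notin rs -> let P := \prod_(w <- rs) ('X - w%:P) in
  P^`().[z] = P.[z] * \sum_(w <- rs) (z - w)^-1.
Proof.
elim: rs => [|w rs IH] /=; first by rewrite !big_nil derivC horner0 mulr0.
rewrite inE negb_or => /andP[zw zrs].
have zw0 : z - w != 0 by rewrite subr_eq0.
rewrite !big_cons derivM derivXsubC !hornerE IH//=.
by field.
Qed.

Lemma logderiv_lower_bound (C : numClosedFieldType) (p : {poly C}) n (z : C) :
  size p = n.+1 -> (forall w, root p w -> `|w| < `|z|) ->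
  n%:R * `|p.[z]| <= 2 * `|z| * `|p^`().[z]|.
Proof.
move=> sp; have [rs ep] := closed_field_poly_normal p => rlt.
have p0 : p != 0 by rewrite -size_poly_eq0 sp.
have lc0 : lead_coef p != 0 by rewrite lead_coef_eq0.
have srs : size rs = n.
  by move: sp; rewrite ep size_scale// size_prod_XsubC => -[].
have rslt w : w \in rs -> `|w| < `|z|.
  by move=> wrs; apply: rlt; rewrite ep rootZ// root_prod_XsubC.
have zrs : z \notin rs by apply/negP => /rslt; rewrite ltxx.
rewrite {2}ep derivZ !hornerZ horner_deriv_prod_XsubC// {1}ep hornerZ.
set P := (\prod_(w <- rs) _).[z]; set S := \sum_(w <- rs) _.
rewrite !normrM -subr_ge0.
rewrite [X in 0 <= X](_ : _ =
  `|lead_coef p| * `|P| * (2 * (`|z| * `|S|) - n%:R)); last by ring.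
rewrite mulr_ge0 ?mulr_ge0// subr_ge0 -normrM mulr_natl.
(* The real part is additive over the roots, listed with multiplicity in [rs], and each of the [n]
   summands contributes at least 1 to the doubled sum. *)
apply: le_trans (_ : 'Re (z * S) *+ 2 <= _); last first.
  rewrite lerMn2r; apply/orP; right.
  apply: le_trans (real_ler_norm (Creal_Re _)) _; exact: leif_normC_Re_Creal.
rewrite /S mulr_sumr raddf_sum/= -sumrMnl -srs.
rewrite -sum1_size natr_sum big_seq [leRHS]big_seq.
apply: ler_sum => w wrs; apply: Re_ge_half.
have zw0 : z - w != 0 by rewrite subr_eq0; apply: contraNneq zrs => ->.
rewrite (_ : z * (z - w)^-1 - 1 = w * (z - w)^-1); last by field.
by rewrite !normrM ler_wpM2r// ltW// rslt.
Qed.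

(** In characteristic zero the leading coefficient survives differentiation, multiplied by the
    degree, so a nonconstant polynomial loses exactly one degree. *)
Lemma size_derivn_num (R : numDomainType) (p : {poly R}) j :
  size p^`(j) = (size p - j)%N.
Proof.
elim: j => [|j IH]; first by rewrite derivn0 subn0.
rewrite derivnS subnS -IH; move: p^`(j) => {IH} q.
have [/size1_polyC -> | q1] := leqP (size q) 1.
  by rewrite derivC size_poly0 size_polyC; case: (_ != 0).
apply/eqP; rewrite eqn_leq; apply/andP; split.
  by rewrite -ltnS prednK ?lt_size_deriv// -?size_poly_gt0 (ltn_trans _ q1).
have e : (size q).-2.+1 = (size q).-1 by case: (size q) q1 => [|[]].
rewrite leqNgt -e ltnS; apply/negP => /leq_sizeP/(_ _ (leqnn _))/eqP.
rewrite coef_deriv e mulrn_eq0 -{1}e /= -lead_coefE lead_coef_eq0.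
by rewrite -size_poly_eq0; case: (size q) q1.
Qed.

(** A Gauss-Lucas statement for discs centred at 0. At a root of the next derivative with modulus at
    least [t], the logarithmic derivative bound would force the previous derivative to vanish
    too. *)
Lemma root_derivn_lt (C : numClosedFieldType) (p : {poly C}) (t : C) j :
  0 <= t -> (j < size p)%N -> (forall w, root p w -> `|w| < t) ->
  forall w, root p^`(j) w -> `|w| < t.
Proof.
move=> t0; elim: j => [//|j IH] jp rlt w.
rewrite derivnS => rw; case: (real_ltP (normr_real w) (ger0_real t0)) => // tw.
have sz : size p^`(j) = (size p - j.+1).+1.
  by rewrite size_derivn_num subnSK // ltnW.
have rltj := IH (ltnW jp) rlt.
have := @logderiv_lower_bound _ _ _ w sz
  (fun v rv => lt_le_trans (rltj v rv) tw).
rewrite (rootP rw) normr0 mulr0 pmulr_rle0 ?ltr0n ?subn_gt0// normr_le0.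
by move=> /rltj /lt_le_trans /(_ tw); rewrite ltxx.
Qed.

(** Every derivative differentiated here has degree at least [n / 2], because its order is below [k]
    and [2 * k <= n]; one differentiation thus costs a factor of at most [4 * |z| / n]. *)
Lemma derivn_lower_bound (C : numClosedFieldType) (p : {poly C}) n k (z : C) :
  size p = n.+1 -> (2 * k <= n)%N -> (forall w, root p w -> `|w| < `|z|) ->
  forall j i, (j + i <= k)%N ->
  n%:R ^+ i * `|p^`(j).[z]| <= (4 * `|z|) ^+ i * `|p^`(j + i).[z]|.
Proof.
move=> sp kn rlt j; elim=> [|i IH]; first by rewrite addn0 !expr0.
rewrite addnS => ik; rewrite exprS -mulrA.
have {IH}h := ler_wpM2l (ler0n _ n) (IH (ltnW ik)).
apply: le_trans h _; rewrite mulrCA exprSr -mulrA ler_wpM2l ?exprn_ge0 ?mulr_ge0//.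
have sz : size p^`(j + i) = (n - (j + i)).+1.
  by rewrite size_derivn_num sp subSn//; lia.
have rltj : forall w, root p^`(j + i) w -> `|w| < `|z|.
  by apply: root_derivn_lt => //; rewrite sp; lia.
rewrite derivnS.
have := ler_wpM2l (ler0n C 2) (logderiv_lower_bound sz rltj).
rewrite mulrA -natrM => h.
rewrite (_ : 4 * `|z| = 2 * (2 * `|z|)); last by rewrite mulrA -natrM.
rewrite -[leRHS]mulrA; apply: le_trans h.
by rewrite ler_wpM2r// ler_nat; lia.
Qed.

(** * Size of polynomial values at large arguments *)

Lemma horner_upper_bound (R : numDomainType) (q : {poly R}) m (z : R) :
  (size q <= m.+1)%N -> 1 <= `|z| ->
  `|q.[z]| <= (\sum_(i < size q) `|q`_i|) * `|z| ^+ m.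
Proof.
move=> sq z1; rewrite horner_coef mulr_suml.
apply: le_trans (ler_norm_sum _ _ _) _; apply: ler_sum => i _.
rewrite normrM normrX ler_wpM2l// ler_weXn2l//.
by have := ltn_ord i; lia.
Qed.

Lemma horner_lower_bound (F : numFieldType) (q : {poly F}) :
  q != 0 -> exists B r : F, [/\ 0 < B, 1 <= r &
    forall z, r <= `|z| -> B * `|z| ^+ (size q).-1 <= `|q.[z]|].
Proof.
move=> q0; pose a := `|lead_coef q|.
have a0 : 0 < a by rewrite normr_gt0 lead_coef_eq0.
pose S := \sum_(i < (size q).-1) `|q`_i|.
have S0 : 0 <= S by apply: sumr_ge0.
(* Beyond this radius the lower terms amount to at most half the leading one. *)
exists (a / 2), (1 + 2 * S / a); split; first by rewrite divr_gt0.
  by rewrite lerDl divr_ge0 ?mulr_ge0// ltW.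
move=> z rz; set t := `|z| in rz *; set e := (size q).-1.
have t1 : 1 <= t.
  by apply: le_trans rz; rewrite lerDl divr_ge0 ?mulr_ge0// ltW.
have t0 : 0 < t by apply: lt_le_trans t1.
have eq : q.[z] = lead_coef q * z ^+ e + \sum_(i < e) q`_i * z ^+ i.
  rewrite horner_coef -(prednK (n := size q)) ?size_poly_gt0//.
  by rewrite big_ord_recr /= addrC.
(* The extra factor [t] avoids the exponent [e - 1], which would truncate at [e = 0]. *)
have low : `|\sum_(i < e) q`_i * z ^+ i| * t <= S * t ^+ e.
  rewrite /S !mulr_suml; apply: le_trans (_ : \sum_(i < e) `|q`_i * z ^+ i| * t <= _).
    by rewrite -mulr_suml; apply: ler_wpM2r; [exact: ltW | exact: ler_norm_sum].
  apply: ler_sum => i _; rewrite normrM normrX -mulrA -exprSr.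
  by rewrite ler_wpM2l// ler_weXn2l.
have St : 2 * S <= a * t.
  by rewrite [a * t]mulrC -ler_pdivrMr//; apply: le_trans rz; rewrite lerDr.
rewrite -(ler_pM2r t0) -[leRHS](addrK (S * t ^+ e)) lerBrDr.
apply: le_trans (_ : a * t ^+ e * t <= _); last first.
  apply: (le_trans _ (lerD (lexx _) low)); rewrite -mulrDl ler_wpM2r ?(ltW t0)//.
  rewrite (_ : a * t ^+ e = `|lead_coef q * z ^+ e|); last by rewrite normrM normrX.
  by rewrite eq; apply: (le_trans _ (ler_normB _ _)); rewrite addrK.
have te : 0 <= t ^+ e by rewrite exprn_ge0 ?ltW.
rewrite -subr_ge0 (_ : _ - _ = t ^+ e / 2 * (a * t - 2 * S)); last by field.
by rewrite mulr_ge0 ?divr_ge0// subr_ge0.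
Qed.

(** * Differences of falling factorials *)

Lemma leq_ffact m n j : (m <= n)%N -> (m ^_ j <= n ^_ j)%N.
Proof.
move=> mn; elim: j => // j IH; rewrite !ffactnSr leq_mul//; lia.
Qed.

(* In the difference of the eigenvalues of degrees n and m, this makes the term
   of index top_index dominate the lower ones by a factor that tends to infinity
   with n, uniformly in m < n. *)
Lemma ffactB_growth m n i j : (m <= n)%N -> (i <= j)%N -> (j < n)%N ->
  ((n - j) * (n ^_ i - m ^_ i) <= n ^_ j.+1 - m ^_ j.+1)%N.
Proof.
move=> mn; elim: j => [|j IH] ij jn.
  by move: ij; rewrite leqn0 => /eqP->; rewrite !ffactn0 subnn muln0.
have step l : ((n - l) * (n ^_ l - m ^_ l) <= n ^_ l.+1 - m ^_ l.+1)%N.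
  rewrite !ffactnSr mulnBr ![((n - l) * _)%N]mulnC leq_sub2l// leq_mul2l; lia.
apply: leq_trans (step _); rewrite leq_mul2l; apply/orP; right.
case: (ltngtP i j.+1) ij => // [ij _|-> //].
by apply: leq_trans (IH _ _); [rewrite leq_pmull//; lia|lia|lia].
Qed.

Lemma ffactB_gt0 m n j : (m < n)%N -> (0 < j <= n)%N -> (m ^_ j < n ^_ j)%N.
Proof.
move=> mn; elim: j => // j IH /= jn.
rewrite !ffactnSr; case: j IH jn => [|j] IH jn; first by rewrite !ffactn0; lia.
have := IH ltac:(lia).
have : (m - j.+1 <= n - j.+1)%N by lia.
have : (0 < n - j.+1)%N by lia.
nia.
Qed.

(** * Triangular action on monomials, eigenvalues and eigenpolynomials *)

Section Diffop.
Context (R : realType) (k : nat) (Q : nat -> {poly R[i]}).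

Lemma diffopD p q : diffop k Q (p + q) = diffop k Q p + diffop k Q q.
Proof.
by rewrite -big_split; apply: eq_bigr => j _; rewrite derivnD mulrDr.
Qed.

Lemma diffopZ c p : diffop k Q (c *: p) = c *: diffop k Q p.
Proof.
by rewrite scaler_sumr; apply: eq_bigr => j _; rewrite derivnZ scalerAr.
Qed.

Lemma diffop0 : diffop k Q 0 = 0.
Proof.
have e : diffop k Q (0 *: 0) = 0 *: diffop k Q 0 by apply: diffopZ.
by rewrite !scale0r in e. Qed.

(** The diagonal entry at z^n of the operator in the monomial basis: D^j sends z^n to [n ^_ j]
    z^(n-j), and only the z^j term of Q_j restores degree [n]. *)
Definition diffop_eigenvalue (n : nat) : R[i] :=
  \sum_(1 <= j < k.+1) (Q j)`_j *+ n ^_ j.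

Hypothesis sQ : forall j, (1 <= j <= k)%N -> (size (Q j) <= j.+1)%N.

Lemma coef_diffop (p : {poly R[i]}) n : (size p <= n.+1)%N ->
  (diffop k Q p)`_n = diffop_eigenvalue n * p`_n.
Proof.
move=> sp; rewrite coef_sum mulr_suml big_nat [RHS]big_nat.
apply: eq_bigr => j /sQ sj; rewrite coefM.
(* For [i < j] the second factor involves a coefficient of [p] above degree [n]; for [i > j] the
   first exceeds the degree bound on [Q j]. *)
have vanish (i : 'I_n.+1) : i != j :> nat -> (Q j)`_i * p^`(j)`_(n - i) = 0.
  move=> ij; case: (ltngtP i j) ij => // ij _.
    by rewrite coef_derivn (nth_default _ (s := p)) ?mul0rn ?mulr0//; lia.
  by rewrite nth_default ?mul0r//; apply: leq_trans sj _.
have [jn|nj] := leqP j n; last first.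
  rewrite ffact_small// mulr0n mul0r big1// => i _; apply: vanish.
  by have := ltn_ord i; lia.
have jn1 : (j < n.+1)%N by [].
rewrite (bigD1 (Ordinal jn1))//= big1 ?addr0 => [|i ij]; last exact: vanish.
by rewrite coef_derivn subnKC// mulrnAr mulrnAl.
Qed.

Lemma size_diffop (p : {poly R[i]}) n : (size p <= n)%N -> (size (diffop k Q p) <= n)%N.
Proof.
move=> sp; apply/leq_sizeP => j nj.
by rewrite coef_diffop ?(nth_default _ (s := p)) ?mulr0//; lia.
Qed.

Lemma diffop_eigenvalueP (p : {poly R[i]}) n lambda : p \is monic -> size p = n.+1 ->
  diffop k Q p = lambda *: p -> lambda = diffop_eigenvalue n.
Proof.
move=> /monicP mp sp /(congr1 (fun q : {poly R[i]} => q`_n)).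
by rewrite coef_diffop ?sp// coefZ -[n]/(n.+1.-1) -sp -lead_coefE mp !mulr1.
Qed.

(** Back substitution from the top coefficient: on polynomials of size at most [m], T - λ_n is
    triangular with nonzero diagonal entries λ_i - λ_n. *)
Lemma diffop_solve n m (g : {poly R[i]}) :
  (forall i, (i < n)%N -> diffop_eigenvalue i != diffop_eigenvalue n) ->
  (m <= n)%N -> (size g <= m)%N ->
  exists2 q : {poly R[i]}, (size q <= m)%N &
    diffop k Q q - diffop_eigenvalue n *: q = g.
Proof.
move=> ev; elim: m g => [|m IH] g mn sg.
  exists 0; rewrite ?size_poly0// diffop0 scaler0 subr0.
  by apply/esym/eqP; rewrite -size_poly_eq0 -leqn0.
pose c := g`_m / (diffop_eigenvalue m - diffop_eigenvalue n).
have sX : (size (c *: 'X^m) <= m.+1)%N.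
  by rewrite (leq_trans (size_scale_leq _ _))// size_polyXn.
pose h := diffop k Q (c *: 'X^m) - diffop_eigenvalue n *: (c *: 'X^m).
have [||q sq eq] := IH (g - h); first exact: ltnW.
  apply/leq_sizeP => j; rewrite leq_eqVlt => /predU1P[<-|mj]; last first.
    rewrite nth_default//; apply: leq_trans mj.
    rewrite (leq_trans (size_polyD _ _))// geq_max sg size_polyN/=.
    rewrite (leq_trans (size_polyD _ _))// geq_max size_diffop//= size_polyN.
    by rewrite (leq_trans (size_scale_leq _ _)).
  rewrite coefB coefB coef_diffop// !coefZ coefXn eqxx mulr1 -mulrBl.
  by rewrite mulrC divfK ?subrr// subr_eq0 ev.
exists (c *: 'X^m + q).
  by rewrite (leq_trans (size_polyD _ _))// geq_max sX leqW.
by rewrite diffopD scalerDr opprD addrACA eq -/h addrC subrK.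
Qed.

Lemma exists_monic_eigenpoly n :
  (forall i, (i < n)%N -> diffop_eigenvalue i != diffop_eigenvalue n) ->
  exists p, is_monic_eigenpoly k Q n p.
Proof.
(* The z^n coefficient of [h] cancels, so (T - λ_n) q = [h] is solvable with deg q < n, and z^n - q
   is the eigenpolynomial. *)
move=> ev; pose h := diffop k Q 'X^n - diffop_eigenvalue n *: 'X^n.
have [||q sq eq] := @diffop_solve n n h ev => //.
  apply/leq_sizeP => j; rewrite leq_eqVlt => /predU1P[<-|nj]; last first.
    rewrite nth_default//; apply: leq_trans nj.
    rewrite (leq_trans (size_polyD _ _))// geq_max size_diffop ?size_polyXn//=.
    by rewrite size_polyN (leq_trans (size_scale_leq _ _))// size_polyXn.
  by rewrite coefB coef_diffop ?size_polyXn// coefZ subrr.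
exists ('X^n - q); have sz : size ('X^n - q) = n.+1.
  by rewrite size_polyDl size_polyXn// size_polyN.
split=> //.
  apply/monicP; rewrite lead_coefE sz coefB coefXn eqxx nth_default ?subr0//.
exists (diffop_eigenvalue n).
rewrite -[- q]scaleN1r diffopD diffopZ !scaleN1r scalerBr.
move/eqP: eq; rewrite subr_eq => /eqP ->; rewrite /h opprD opprB addrA.
by rewrite [_ + (_ - _)]addrC subrK.
Qed.

End Diffop.

(** * The index j_0 and separation of eigenvalues *)

Section DegenerateExactlySolvable.
Context (R : realType) (k : nat) (Q : nat -> {poly R[i]}).
Hypothesis hT : degenerate_exactly_solvable k Q.

Let j0 := top_index k Q.

Lemma degenerate_size j : (1 <= j <= k)%N -> (size (Q j) <= j.+1)%N.
Proof.
case: hT => _ h _ _ jk; have [->|Qj] := eqVneq (Q j) 0; first by rewrite size_poly0.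
by have := h j jk Qj; rewrite /pdeg; lia.
Qed.

(** Some index attains equality of degrees, so the maximum is not its default 0; deg Q_k < k
    excludes [k]. Above [j0] all degrees are strict, so diagonal coefficients vanish. *)
Lemma top_index_lead : [/\ (0 < j0 < k)%N, (Q j0)`_j0 != 0
  & forall j, (j0 < j <= k)%N -> (Q j)`_j = 0].
Proof.
have top j : (1 <= j <= k)%N -> Q j != 0 -> pdeg (Q j) = j -> (j <= j0)%N.
  move=> jk Qj dj; rewrite /j0 /top_index.
  by apply: leq_bigmax_seq; rewrite ?mem_index_iota ?Qj ?dj /=.
have [Qk dQ [j [jk Qj dj]] dk] := hT.
have j0P : j0 = 0%N \/ [/\ (1 <= j0 <= k)%N, Q j0 != 0 & pdeg (Q j0) = j0].
  rewrite /j0 /top_index big_nat_cond.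
  elim/big_ind: _ => [|x y ? ?|i /and3P[ik Qi /eqP di]]; first by left.
    by case: (leqP x y).
  by right.
have jj0 := top j jk Qj dj.
case: j0P => [|[j0k Q0 d0]]; first by move: jk jj0; case: (j0); lia.
split=> [||i ij].
- have [e|/eqP ne] := eqVneq j0 k; last by lia.
  by move: dk; rewrite -e d0; lia.
- by move: Q0; rewrite -lead_coef_eq0 lead_coefE -/(pdeg _) d0.
- have ik : (1 <= i <= k)%N by lia.
  have := degenerate_size ik; rewrite leq_eqVlt => /predU1P[si|]; last first.
    by move=> si; rewrite nth_default.
  have Qi : Q i != 0 by rewrite -size_poly_eq0 si.
  by have := top i ik Qi; rewrite /pdeg si /= => /(_ erefl); lia.
Qed.

(** If two eigenvalues agreed, the [j0] term of their difference would be balanced by the lower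
    ones, which are smaller by a factor [n - j0 + 1]; this bounds that factor by the coefficient
    ratio [S]. *)
Lemma eigenvalue_separated : exists N, forall n m, (N <= n)%N -> (m < n)%N ->
  diffop_eigenvalue k Q m != diffop_eigenvalue k Q n.
Proof.
have [j0k a0 top] := top_index_lead.
pose S : R[i] := (\sum_(1 <= j < j0) `|(Q j)`_j|) / `|(Q j0)`_j0|.
have S0 : 0 <= S by rewrite divr_ge0// sumr_ge0.
have ReS : S = (complex.Re S)%:C by rewrite RRe_real// ger0_real.
have rS0 : 0 <= complex.Re S by rewrite -ler0c -ReS.
exists (j0 + Num.bound (complex.Re S))%N => n m Nn mn.
apply/eqP => /esym/eqP; rewrite -subr_eq0 => /eqP.
rewrite /diffop_eigenvalue -sumrB.
rewrite (big_cat_nat (n := j0.+1)) //=; try lia.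
rewrite [X in _ + X]big_nat [X in _ + X]big1 => [|j jk]; last first.
  by rewrite top ?mul0rn ?subrr//; lia.
rewrite addr0 big_nat_recr /=; last by clear -j0k; lia.
pose D j := (n ^_ j - m ^_ j)%N.
have DE j : (Q j)`_j *+ n ^_ j - (Q j)`_j *+ m ^_ j = (Q j)`_j *+ D j.
  by rewrite -mulrnBr// leq_ffact// ltnW.
rewrite DE (eq_bigr _ (fun j _ => DE j)) => /eqP.
rewrite addrC addr_eq0 => /eqP /(congr1 Num.norm); rewrite normrN.
have D0 : (0 < D j0)%N by rewrite subn_gt0 ffactB_gt0//; lia.
rewrite normrMn => e.
have : `|(Q j0)`_j0| *+ D j0 *+ (n - j0).+1 <=
       (\sum_(1 <= j < j0) `|(Q j)`_j|) *+ D j0.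
  rewrite e.
  apply: (@le_trans _ _ ((\sum_(1 <= j < j0) `|(Q j)`_j *+ D j|) *+ (n - j0).+1)).
    by rewrite lerMn2r ler_norm_sum orbT.
  rewrite -!sumrMnl big_nat [leRHS]big_nat; apply: ler_sum => j jj0.
  rewrite normrMn -mulrnA ler_wpMn2l//.
  (* Taken at [j0 - 1], so that the right side is the difference of order [j0] and the factor is
     [n - j0 + 1]. *)
  have h := @ffactB_growth m n j j0.-1 (ltnW mn).
  rewrite prednK in h; last by lia.
  by rewrite mulnC; apply: leq_trans (h _ _); rewrite ?leq_mul2r; lia.
rewrite -mulrnA mulnC mulrnA lerMn2r eqn0Ngt D0 /=.
rewrite -mulr_natr -ler_pdivlMl ?normr_gt0// mulrC -/S ReS.
rewrite (_ : (n - j0).+1%:R = (n - j0).+1%:R%:C); last by rewrite rmorph_nat.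
rewrite lecR leNgt => /negP; apply.
apply: lt_le_trans (archi_boundP rS0) _; rewrite ler_nat; lia.
Qed.

(** * Size of the eigenvalues and the main estimate *)

Let coef_norm j : R[i] := \sum_(i < size (Q j)) `|(Q j)`_i|.

Let coef_norm_ge0 j : 0 <= coef_norm j.
Proof. exact: sumr_ge0. Qed.

Lemma norm_eigenvalue_le n : (0 < n)%N ->
  `|diffop_eigenvalue k Q n| <= (\sum_(1 <= j < k.+1) coef_norm j) * n%:R ^+ j0.
Proof.
move=> n0; have [_ _ top] := top_index_lead.
rewrite mulr_suml; apply: le_trans (ler_norm_sum _ _ _) _.
rewrite big_nat [leRHS]big_nat; apply: ler_sum => j jk.
have [jj0|j0j] := leqP j j0; last first.
  by rewrite top ?mul0rn ?normr0 ?mulr_ge0 ?exprn_ge0//; lia.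
rewrite normrMn -[X in X <= _]mulr_natr; apply: ler_pM => //.
  have [js|sj] := ltnP j (size (Q j)); last first.
    by rewrite nth_default// normr0.
  by rewrite /coef_norm (bigD1 (Ordinal js))//= lerDl sumr_ge0.
rewrite -natrX ler_nat; apply: leq_trans (_ : n ^ j <= _)%N.
  rewrite ffact_prod; apply: leq_trans (_ : \prod_(i < j) n <= _)%N.
    by apply: leq_prod => i _; apply: leq_subr.
  by rewrite prod_nat_const card_ord.
by rewrite leq_pexp2l.
Qed.

Hypothesis hQ : forall j : nat, (j0 < j <= k)%N -> Q j != 0 ->
  (k - pdeg (Q k) <= j - pdeg (Q j))%N.

(** Denominators are cleared: the eigenvalue equation is multiplied by n^k and compared with
    |p^(k)(z)|, and the common factor t^(deg Q_k) n^j0 is cancelled at the end. *)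
Lemma eigenpoly_estimate : exists B K r : R[i], [/\ 0 < B, 0 <= K, 1 <= r &
  forall n (p : {poly R[i]}) (z : R[i]), is_monic_eigenpoly k Q n p -> (2 * k <= n)%N ->
    r <= `|z| -> (forall w, root p w -> `|w| < `|z|) ->
    B * n%:R ^+ (k - j0) <=
    K * (`|z| ^+ (k - pdeg (Q k)) + n%:R ^+ (k - j0).-1)].
Proof.
have [Qk dQ _ dk] := hT; have [j0k _ _] := top_index_lead.
have [B [r [B0 r1 lowQk]]] := horner_lower_bound Qk.
pose A := \sum_(1 <= j < k.+1) coef_norm j.
have A0 : 0 <= A by apply: sumr_ge0.
(* The factor 2 counts the eigenvalue term and the sum over [j < k], each at most
   [A * (4 ^+ k * E * P)] below. *)
exists B, (2 * (4 ^+ k * A)), r; split=> //; first by rewrite !mulr_ge0 ?exprn_ge0.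
move=> n p z [mp sp [lambda ep]] kn rz rlt.
have el := diffop_eigenvalueP degenerate_size mp sp ep.
set t := `|z| in rz rlt *; set e := pdeg (Q k) in dk *.
have t1 : 1 <= t by apply: le_trans rz.
have t0 : 0 < t by apply: lt_le_trans t1.
have n0 : (0 < n)%N by lia.
pose N : R[i] := n%:R; have N1 : 1 <= N by rewrite ler1n.
have N0 : 0 < N by rewrite ltr0n.
pose P := `|p^`(k).[z]|.
have P0 : 0 < P.
  rewrite normr_gt0; apply/negP => /eqP/rootP rz'.
  have := @root_derivn_lt _ p t k (ltW t0) _ rlt z rz'.
  by rewrite ltxx sp => /(_ ltac:(clear -kn; lia)).
have low j : (j <= k)%N ->
    N ^+ k * `|p^`(j).[z]| <= 4 ^+ k * (N ^+ j * t ^+ (k - j)) * P.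
  move=> jk; have := @derivn_lower_bound _ p n k z sp kn rlt j (k - j).
  rewrite subnKC// leqnn => /(_ isT) h.
  have -> : N ^+ k = N ^+ j * N ^+ (k - j) by rewrite -exprD subnKC.
  rewrite -mulrA.
  apply: le_trans (ler_wpM2l _ h) _; first by rewrite exprn_ge0// ltW.
  rewrite -/P -/t [leLHS]mulrA ler_wpM2r ?(ltW P0)// exprMn mulrCA.
  rewrite ler_wpM2r ?mulr_ge0 ?exprn_ge0 ?(ltW t0) ?(ltW N0)//.
  by rewrite ler_weXn2l ?leq_subr// ler1n.
(* The first summand absorbs the eigenvalue and the indices [j <= j0], the second those with
   [j0 < j < k]. *)
pose E := t ^+ k * N ^+ j0 + t ^+ e * N ^+ k.-1.
have E1 : t ^+ k * N ^+ j0 <= E.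
  by rewrite lerDl mulr_ge0 ?exprn_ge0// ltW.
have E2 : t ^+ e * N ^+ k.-1 <= E.
  by rewrite lerDr mulr_ge0 ?exprn_ge0// ltW.
have b4 : 0 <= 4 ^+ k :> R[i] by rewrite exprn_ge0.
have term j : (1 <= j < k)%N ->
    N ^+ k * `|(Q j * p^`(j)).[z]| <= coef_norm j * (4 ^+ k * E * P).
  move=> jk; rewrite hornerM normrM mulrCA.
  have [Qj0 | Qj] := eqVneq (Q j) 0.
    by rewrite /coef_norm Qj0 horner0 normr0 mul0r size_poly0 big_ord0 mul0r.
  have jk1 : (1 <= j <= k)%N by clear -jk; lia.
  have lowj := low j (proj2 (andP jk1)).
  have [m [sm hm]] : exists m, (size (Q j) <= m.+1)%N /\
      t ^+ m * (N ^+ j * t ^+ (k - j)) <= E.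
    have dj := dQ j jk1 Qj.
    have [jj0|j0j] := leqP j j0.
      exists j; split; first exact: degenerate_size.
      apply: le_trans E1; rewrite mulrCA -exprD subnKC; last by case/andP: jk1.
      rewrite mulrC ler_wpM2l ?exprn_ge0 ?(ltW t0)//.
      by rewrite ler_weXn2l.
    have hj : (k - e <= j - pdeg (Q j))%N.
      by apply: hQ => //; rewrite j0j; case/andP: jk1.
    (* By hypothesis this exponent is at least deg Q_j; adding the [k - j] from the derivative bound
       gives exactly [e]. *)
    exists (j - (k - e))%N; split; first by move: hj dj; clear; rewrite /pdeg; lia.
    apply: le_trans E2; rewrite mulrCA -exprD.
    rewrite (_ : j - (k - e) + (k - j) = e)%N; last first.
      by move: hj jk1 dk; clear; lia.
    rewrite mulrC ler_wpM2l ?exprn_ge0 ?(ltW t0)//.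
    by rewrite ler_weXn2l//; clear -jk; lia.
  have up := horner_upper_bound sm t1.
  apply: le_trans (ler_pM _ _ up lowj) _ => //.
    by rewrite mulr_ge0// exprn_ge0// ltW.
  rewrite -/(coef_norm j) -/t -!mulrA ler_wpM2l//.
  rewrite mulrCA ler_wpM2l// !mulrA ler_wpM2r ?(ltW P0)//.
  by rewrite -mulrA.
have key : B * t ^+ e * N ^+ k <= 2 * (4 ^+ k * A) * E.
  rewrite -(ler_pM2r P0).
  have : N ^+ k * `|(Q k * p^`(k)).[z]| <=
      N ^+ k * `|lambda| * `|p.[z]| + \sum_(1 <= j < k) N ^+ k * `|(Q j * p^`(j)).[z]|.
    rewrite -mulr_sumr -mulrA -mulrDr ler_wpM2l ?exprn_ge0 ?(ltW N0)//.
    rewrite (_ : (Q k * _).[z] = lambda * p.[z] - \sum_(1 <= j < k) (Q j * p^`(j)).[z]).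
      rewrite -normrM; apply: le_trans (ler_normB _ _) _.
      by rewrite lerD2l ler_norm_sum.
    rewrite -hornerZ -ep /diffop horner_sum big_nat_recr /=; last by clear -j0k; lia.
    by rewrite addrAC subrr add0r.
  rewrite hornerM normrM => h.
  apply: le_trans (_ : N ^+ k * (`|(Q k).[z]| * P) <= _).
    rewrite (_ : _ * _ * P = N ^+ k * (B * t ^+ e * P)); last by ring.
    rewrite ler_wpM2l ?exprn_ge0 ?(ltW N0)// ler_wpM2r ?(ltW P0)//.
    exact: lowQk.
  apply: le_trans h _.
  rewrite (_ : _ * E * P = A * (4 ^+ k * E * P) + A * (4 ^+ k * E * P)); last by ring.
  apply: lerD.
    have := low 0%N isT; rewrite derivn0 subn0 expr0 mul1r => low0.
    rewrite [N ^+ k * _]mulrC.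
    have hl : `|lambda| <= A * N ^+ j0 by rewrite el; apply: norm_eigenvalue_le.
    rewrite -[leLHS]mulrA; apply: le_trans (ler_pM _ _ hl low0) _ => //.
      by rewrite mulr_ge0// exprn_ge0// ltW.
    rewrite [leLHS](_ : _ = A * 4 ^+ k * P * (t ^+ k * N ^+ j0)); last by ring.
    rewrite [leRHS](_ : _ = A * 4 ^+ k * P * E); last by ring.
    by rewrite ler_wpM2l// !mulr_ge0// ltW.
  apply: le_trans (_ : \sum_(1 <= j < k) coef_norm j * (4 ^+ k * E * P) <= _).
    by rewrite big_nat [leRHS]big_nat; apply: ler_sum.
  rewrite -mulr_suml /A big_nat_recr /=; last by clear -j0k; lia.
  rewrite ler_wpM2r ?lerDl// !mulr_ge0// ?(ltW P0)//.
  by apply: le_trans E1; rewrite mulr_ge0 ?exprn_ge0// ltW.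
have D0 : 0 < t ^+ e * N ^+ j0 by rewrite mulr_gt0// exprn_gt0.
rewrite -/N -(ler_pM2r D0).
have eN : N ^+ k = N ^+ (k - j0) * N ^+ j0.
  by rewrite -exprD subnK//; clear -j0k dk; lia.
have eN' : N ^+ k.-1 = N ^+ (k - j0).-1 * N ^+ j0.
  by rewrite -exprD; congr (_ ^+ _); clear -j0k; lia.
have et : t ^+ k = t ^+ (k - e) * t ^+ e by rewrite -exprD subnK//; clear -j0k dk; lia.
move: key; rewrite /E eN eN' et => key.
rewrite (_ : _ * (t ^+ e * _) = B * t ^+ e * (N ^+ (k - j0) * N ^+ j0)); last by ring.
by apply: le_trans key _; rewrite le_eqVlt; apply/orP; left; apply/eqP; ring.
Qed.

End DegenerateExactlySolvable.

(** * Root radius, lower limit and growth exponent *)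

Lemma norm_realC (R : realType) (z : R[i]) : `|z| = (complex.Re `|z|)%:C.
Proof. by rewrite RRe_real. Qed.

Lemma root_radius_ge (R : realType) (p : {poly R[i]}) (w : R[i]) :
  p != 0 -> root p w -> `|w| <= (root_radius p)%:C.
Proof.
move=> p0 rw; rewrite norm_realC lecR; apply: ub_le_sup; last by exists w.
have [rs ep] := closed_field_poly_normal p.
(* The sum of the moduli of all roots serves as the upper bound that makes the supremum
   meaningful. *)
exists (\sum_(v <- rs) complex.Re `|v|) => _ [v rv <-].
have vrs : v \in rs.
  by move: rv; rewrite /= ep rootZ ?lead_coef_eq0// root_prod_XsubC.
rewrite (big_rem v) //= lerDl sumr_ge0// => u _.
by rewrite -ler0c -norm_realC.
Qed.

(** Constants and the zero polynomial are covered, since [sup] is 0 on a set without a supremum. *)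
Lemma root_radius_ge0 (R : realType) (p : {poly R[i]}) : 0 <= root_radius p.
Proof.
have nn (r : R) :
    [set complex.Re `|z| | z in [set z : R[i] | root p z]]%classic r -> 0 <= r.
  by move=> [z _ <-]; rewrite -ler0c -norm_realC.
have [[E0 Eub]|] := pselect (has_sup
    [set complex.Re `|z| | z in [set z : R[i] | root p z]]%classic).
  have [x Ex] := E0; apply: le_trans (nn x Ex) _.
  exact: ub_le_sup.
by move=> /sup_out; rewrite /root_radius => ->.
Qed.

Lemma limn_einf_ge (R : realType) (u : nat -> \bar R) (c : \bar R) N :
  (forall n, (N <= n)%N -> (c <= u n)%E) -> (c <= limn_einf u)%E.
Proof.
move=> h; rewrite limn_einf_lim (cvg_lim _ (@cvg_einfs_sup _ u))//.
apply: le_trans (ereal_sup_ubound _); last by exists N.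
by apply: le_ereal_inf_tmp => _ [n Nn <-]; apply: h.
Qed.

Lemma powR_ge_eventually (R : realType) (d M : R) : 0 < d ->
  exists N, forall n, (N <= n)%N -> M <= n%:R `^ d.
Proof.
move=> d0; pose x := Num.max M 0 `^ d^-1.
exists (Num.bound x) => n Nn.
apply: (@le_trans _ _ (Num.max M 0)); first by rewrite le_max lexx.
have x0 : 0 <= x by apply: powR_ge0.
have e : x `^ d = Num.max M 0.
  by rewrite -powRrM mulVf ?gt_eqF// powRr1// le_max lexx orbT.
rewrite -e; apply: ge0_ler_powR; rewrite ?nnegrE ?(ltW d0)//.
by apply: ltW; apply: lt_le_trans (archi_boundP x0) _; rewrite ler_nat.
Qed.

(** The term at [j = k] has both the largest numerator and, by hypothesis, the smallest
    denominator. *)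
Lemma growth_exponentE (R : realType) k (Q : nat -> {poly R[i]}) :
  degenerate_exactly_solvable k Q ->
  (forall j : nat, (top_index k Q < j <= k)%N -> Q j != 0 ->
    (k - pdeg (Q k) <= j - pdeg (Q j))%N) ->
  growth_exponent k Q = (k - top_index k Q)%:R / (k - pdeg (Q k))%:R.
Proof.
move=> hT hQ; have [Qk _ _ dk] := hT; have [j0k _ _] := top_index_lead hT.
apply/eqP; rewrite eq_le; apply/andP; split; last first.
  apply: (@Order.TotalTheory.le_bigmax_seq _ R _ _ 0 k (fun j => Q j != 0)
    (fun j => (j - top_index k Q)%:R / (j - pdeg (Q j))%:R)) => //.
  by rewrite mem_index_iota; lia.
rewrite /growth_exponent big_nat_cond; apply: bigmax_le.
  by rewrite divr_ge0.
move=> j /andP[jk Qj].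
have hj := hQ j ltac:(lia) Qj.
apply: ler_pM; rewrite ?invr_ge0//; first by rewrite ler_nat; lia.
by rewrite lef_pV2 ?posrE ?ltr0n ?ler_nat//; lia.
Qed.

(** * Growth of the root radius *)

Lemma root_radius_growth (R : realType) k (Q : nat -> {poly R[i]}) :
  degenerate_exactly_solvable k Q ->
  (forall j : nat, (top_index k Q < j <= k)%N -> Q j != 0 ->
    (k - pdeg (Q k) <= j - pdeg (Q j))%N) ->
  exists (a r : R) (N : nat), [/\ 0 < a, 0 <= r &
    forall n p, (N <= n)%N -> is_monic_eigenpoly k Q n p ->
    a * n%:R ^+ (k - top_index k Q) <=
    (root_radius p + r) ^+ (k - pdeg (Q k))].
Proof.
move=> hT hQ; have [j0k _ _] := top_index_lead hT.
have [B [K [r [B0 K0 r1 est]]]] := eigenpoly_estimate hT hQ.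
(* The constants live in [R[i]]; comparability with 0 makes them real, and the estimate descends to
   [R]. *)
have /complex_realP[B' eB] : B \is Num.real by rewrite gtr0_real.
have /complex_realP[K' eK] : K \is Num.real by rewrite ger0_real.
have /complex_realP[r' er] : r \is Num.real.
  by rewrite ger0_real// (le_trans ler01).
move: B0 K0 r1 est; rewrite {}eB {}eK {}er.
move: {B K r} B' K' r' => B K r.
rewrite (ltcR 0 B) (lecR 0 K) (lecR 1 r) => B0 K0 r1 est.
have K1 : 0 < K + 1 by rewrite ltr_pwDr.
have x0 : 0 <= 2 * (K + 1) / B by rewrite divr_ge0 ?mulr_ge0 ?ltW.
(* For such [n] the error term with exponent [k - j0 - 1] is at most half of the left side; [K + 1]
   replaces [K], which may be 0. *)
exists (B / (2 * (K + 1))), r, (2 * k + Num.bound (2 * (K + 1) / B))%N.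
split; [by rewrite divr_gt0// mulr_gt0|exact: le_trans r1|].
move=> n p Nn np; have [_ sp _] := np.
have rr0 := root_radius_ge0 p.
pose t := root_radius p + r.
have t0 : 0 <= t by rewrite addr_ge0// (le_trans _ r1).
have nt : `|t%:C| = t%:C by rewrite ger0_norm// ler0c.
have rt : r%:C <= `|t%:C| by rewrite nt lecR lerDr.
have rlt w : root p w -> `|w| < `|t%:C|.
  move=> rw; rewrite nt; apply: le_lt_trans (root_radius_ge _ rw) _.
    by rewrite -size_poly_eq0 sp.
  by rewrite ltcR ltrDl (lt_le_trans _ r1).
have := est n p t%:C np ltac:(clear -Nn; lia) rt rlt; rewrite nt.
have nC : n%:R = (n%:R : R)%:C :> R[i] by rewrite rmorph_nat.
rewrite nC -!(rmorphXn (real_complex R)) -(rmorphD (real_complex R)).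
rewrite -!(rmorphM (real_complex R)) lecR => h.
have n0 : (n%:R : R) ^+ (k - top_index k Q).-1 >= 0 by rewrite exprn_ge0.
have nx : 2 * (K + 1) <= B * n%:R.
  rewrite [B * _]mulrC -ler_pdivrMr//.
  apply: ltW; apply: lt_le_trans (archi_boundP x0) _.
  by rewrite ler_nat; clear -Nn; lia.
rewrite mulrAC ler_pdivrMr ?mulr_gt0// -/t.
have en : (n%:R : R) ^+ (k - top_index k Q) =
    n%:R * n%:R ^+ (k - top_index k Q).-1.
  by rewrite -exprS prednK// subn_gt0; clear -j0k; lia.
have tk0 : 0 <= t ^+ (k - pdeg (Q k)) by rewrite exprn_ge0.
have := ler_wpM2r n0 nx; move: h.
rewrite en => h hm; clear -h hm n0 tk0; lra.
Qed.

Theorem theorem4 (R : realType) (k : nat) (Q : nat -> {poly R[i]})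
  (hT : degenerate_exactly_solvable k Q)
  (hQ : forall j : nat, (top_index k Q < j <= k)%N -> Q j != 0 ->
          (k - pdeg (Q k) <= j - pdeg (Q j))%N) :
  let d : R := growth_exponent k Q in
  d = (k - top_index k Q)%:R / (k - pdeg (Q k))%:R /\
  exists c : R, 0 < c /\
    (c%:E <= limn_einf (fun n : nat =>
                (root_radius (monic_eigenpoly k Q n) / n%:R `^ d)%:E))%E.
Proof.
move=> d; have dE := growth_exponentE hT hQ; split=> //.
have [_ _ _ dk] := hT; have [j0k _ _] := top_index_lead hT.
have [a [r [N1 [a0 r0 growth]]]] := root_radius_growth hT hQ.
have [N2 sep] := eigenvalue_separated hT.
set s : R := (k - pdeg (Q k))%:R in dE.
have s0 : 0 < s by rewrite ltr0n subn_gt0.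
have d0 : 0 < d by rewrite /d dE divr_gt0// ltr0n; lia.
(* Taking [s]-th roots in [growth] turns it into c n^d <= r_n + r. *)
pose c := a `^ s^-1; have c0 : 0 < c by apply: powR_gt0.
(* Beyond [N3] the constant [r] is at most half of c n^d, whence the final [c / 2]; the 1 keeps n^d
   positive for the division. *)
have [N3 big] := @powR_ge_eventually R d (Num.max 1 (2 * r / c)) d0.
exists (c / 2); split; first by rewrite divr_gt0.
apply: (@limn_einf_ge _ _ _ (N1 + N2 + N3)) => n Nn; rewrite lee_fin.
(* Separation of eigenvalues beyond [N2] excludes the default value 0 of [xget]. *)
have eigen : is_monic_eigenpoly k Q n (monic_eigenpoly k Q n).
  apply: (xgetPex 0); apply: (exists_monic_eigenpoly (degenerate_size hT)).
  by move=> m mn; apply: sep => //; lia.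
move: (monic_eigenpoly k Q n) eigen => p eigen.
have /(_ ltac:(lia)) := big n; rewrite ge_max => /andP[nd1 ndr].
have nd0 : 0 < n%:R `^ d by apply: lt_le_trans nd1.
have t0 : 0 <= root_radius p + r by rewrite addr_ge0// root_radius_ge0.
have low : c * n%:R `^ d <= root_radius p + r.
  have := growth n p ltac:(clear -Nn; lia) eigen.
  rewrite -[_ ^+ (k - pdeg _)]powR_mulrn// -[n%:R ^+ _]powR_mulrn// -/s => h.
  have si : 0 <= s^-1 by rewrite invr_ge0 ltW.
  have := ge0_ler_powR si _ _ h; rewrite !nnegrE.
  rewrite mulr_ge0 ?powR_ge0 ?(ltW a0)// => /(_ isT isT).
  rewrite powRM ?powR_ge0 ?(ltW a0)// -!powRrM mulfV ?gt_eqF// powRr1//.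
  by rewrite /d dE.
rewrite ler_pdivlMr//; move: ndr; rewrite ler_pdivrMr// => ndr.
by move: low ndr; nra.
Qed.
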